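(* The operation $!(\ ):\mathrm{End}(\mathbb N)\to\mathrm{End}(\mathbb N)$ is a monoid homomorphism.
   Context: $\mathbb N=\{0,1,2,\dots\}$. $\mathrm{End}(\mathbb N)$ is the monoid of partial injections $\mathbb N\to\mathbb N$ (partial functions that are injective on their domain of definition) under composition of partial functions, with identity $1_{\mathbb N}$. For $f,g\in\mathrm{End}(\mathbb N)$, $f\times g$ is the partial injection $(x,y)\mapsto (f(x),g(y))$ on $\mathbb N\times\mathbb N$, defined exactly when both $f(x)$ and $g(y)$ are defined. The exponential bijection is $\psi:\mathbb N\times\mathbb N\to\mathbb N$, $\psi(x,y)=2^{y+1}x+2^y-1$. The exponential tensor is $f\odot g=\psi\,(f\times g)\,\psi^{-1}$. The bang operation $!(\ ):\mathrm{End}(\mathbb N)\to\mathrm{End}(\mathbb N)$ is $!(f)=1_{\mathbb N}\odot f$. *)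

(* Defs.v *)
From HB Require Import structures.
From mathcomp Require Import all_boot.
From mathcomp Require Import boolp.

Set Implicit Arguments.
Unset Strict Implicit.
Unset Printing Implicit Defensive.

(* Partial functions A -> B are encoded as total functions A -> option B:
   [pfun f x = None] means that f is undefined at x. *)
Record pinj (A B : Type) : Type := PInj {
  pfun :> A -> option B;
  pfun_inj : forall x y z, pfun x = Some z -> pfun y = Some z -> x = y
}.

Lemma pinj_ext (A B : Type) (f g : pinj A B) : f =1 g -> f = g.
Proof.
case: f g => [f f_inj] [g g_inj] /= /funext eq_fg.
by subst g; congr PInj; exact: Prop_irrelevance.
Qed.

Section Total.
Variables (A B : Type) (f : A -> B) (f_inj : injective f).

Fact pinj_total_subproof x y z :
  Some (f x) = Some z -> Some (f y) = Some z -> x = y.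
Proof. by move=> [<-] [/esym/f_inj]. Qed.

Definition pinj_total : pinj A B :=
  PInj (pfun := fun x => Some (f x)) pinj_total_subproof.

End Total.

Definition pinj_id (A : Type) : pinj A A := pinj_total (@inj_id A).

Section Composition.
Variables (A B C : Type) (f : pinj B C) (g : pinj A B).

Fact pinj_comp_subproof x y z :
  obind f (g x) = Some z -> obind f (g y) = Some z -> x = y.
Proof.
case gx: (g x) => [u|] //=; case gy: (g y) => [v|] //= fu fv.
by apply: pfun_inj gx _; rewrite gy (pfun_inj fu fv).
Qed.

(* [pinj_comp f g] applies g first. *)
Definition pinj_comp : pinj A C :=
  PInj (pfun := fun x => obind f (g x)) pinj_comp_subproof.

End Composition.

Section Product.
Variables (A B C D : Type) (f : pinj A C) (g : pinj B D).

Definition pinj_prod_fun (p : A * B) : option (C * D) :=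
  if f p.1 is Some u then
    if g p.2 is Some v then Some (u, v) else None
  else None.

Fact pinj_prod_subproof p q r :
  pinj_prod_fun p = Some r -> pinj_prod_fun q = Some r -> p = q.
Proof.
rewrite /pinj_prod_fun; case: p q => [x y] [x' y'] /=.
case fx: (f x) => [u|] //; case gy: (g y) => [v|] // [<-].
case fx': (f x') => [u'|] //; case gy': (g y') => [v'|] // [eu ev].
by subst u' v'; rewrite (pfun_inj fx fx') (pfun_inj gy gy').
Qed.

Definition pinj_prod : pinj (A * B) (C * D) :=
  PInj (pfun := pinj_prod_fun) pinj_prod_subproof.

End Product.

Definition End (T : Type) : Type := pinj T T.

Section EndMonoid.
Variable T : Type.

HB.instance Definition _ := gen_eqMixin (End T).
HB.instance Definition _ := gen_choiceMixin (End T).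

Fact pinj_compA : associative (@pinj_comp T T T).
Proof. by move=> f g h; apply: pinj_ext => x /=; case: (h x). Qed.

Fact pinj_comp1f : left_id (pinj_id T) (@pinj_comp T T T).
Proof. by move=> f; apply: pinj_ext => x /=; case: (f x). Qed.

Fact pinj_compf1 : right_id (pinj_id T) (@pinj_comp T T T).
Proof. by move=> f; apply: pinj_ext. Qed.

HB.instance Definition _ :=
  isMonoid.Build (End T) pinj_compA pinj_comp1f pinj_compf1.

End EndMonoid.

(* The truncated subtraction of nat is harmless here, as 1 <= 2 ^ y. *)
Definition psi (p : nat * nat) : nat := 2 ^ p.2.+1 * p.1 + 2 ^ p.2 - 1.

(* psi (x, y) + 1 = 2 ^ y * (2 * x + 1), whence the inverse. *)
Definition psi_inv (n : nat) : nat * nat :=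
  ((n.+1 %/ 2 ^ logn 2 n.+1)./2, logn 2 n.+1).

Lemma psiS x y : (psi (x, y)).+1 = 2 ^ y * x.*2.+1.
Proof.
rewrite /psi /= subn1 prednK; last by rewrite addn_gt0 expn_gt0 orbT.
by rewrite expnS mulnS -mul2n addnC; congr (_ + _); rewrite mulnCA mulnA.
Qed.

Lemma psiK : cancel psi psi_inv.
Proof.
move=> [x y]; rewrite /psi_inv psiS.
have -> : logn 2 (2 ^ y * x.*2.+1) = y.
  rewrite lognM ?expn_gt0 // pfactorK // lognE dvdn2 /= odd_double /=.
  by rewrite addn0.
by rewrite mulKn ?expn_gt0 // -[x.*2.+1]/(true + x.*2) half_bit_double.
Qed.

Lemma psi_invK : cancel psi_inv psi.
Proof.
move=> n; apply: succn_inj; rewrite psiS.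
have [//|m odd_m def_n] := @pfactor_coprime 2 n.+1 isT.
rewrite coprime2n in odd_m.
rewrite {2}def_n mulnK ?expn_gt0 // [RHS]def_n mulnC; congr (_ * _).
by rewrite -[RHS]odd_double_half odd_m.
Qed.

Definition psi_pinj : pinj (nat * nat) nat := pinj_total (can_inj psiK).
Definition psi_inv_pinj : pinj nat (nat * nat) := pinj_total (can_inj psi_invK).

Definition exp_tensor (f g : End nat) : End nat :=
  pinj_comp (pinj_comp psi_pinj (pinj_prod f g)) psi_inv_pinj.

Definition bang (f : End nat) : End nat := exp_tensor 1%g f.

(* Main.v *)
Require Import Defs.
From mathcomp Require Import all_boot.

(** The product of partial injections is a bifunctor: it preserves identities
    and satisfies the interchange law
    [(f' f) x (g' g) = (f' x g') (f x g)] ([pinj_prod1], [pinj_prodM]).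
    Conjugation by the bijection [psi] is a monoid isomorphism from
    [End (nat * nat)] onto [End nat], since the inner [psi^-1 psi] of a product
    of two conjugates cancels. Hence the exponential tensor, the composite of
    the two, is a monoid homomorphism in the pair of its arguments
    ([exp_tensor1], [exp_tensorM]). Fixing the first argument to be the
    idempotent [1 = 1 * 1] leaves a homomorphism in the second one, which is
    the bang. *)

Lemma pinj_prod1 (A B : Type) :
  pinj_prod (pinj_id A) (pinj_id B) = pinj_id (A * B).
Proof. by apply: pinj_ext => -[x y]. Qed.

(** The two sides have the same domain: although [pinj_prod] tests its first
    factor before the second, either side is undefined as soon as one of the
    four applications involved is. *)
Lemma pinj_prodM (A B C A' B' C' : Type) (f' : pinj B C) (f : pinj A B)
    (g' : pinj B' C') (g : pinj A' B') :
  pinj_prod (pinj_comp f' f) (pinj_comp g' g) =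
  pinj_comp (pinj_prod f' g') (pinj_prod f g).
Proof.
apply: pinj_ext => -[x y]; rewrite /= /pinj_prod_fun /=.
by case: (f x) => [u|] //=; case: (g y) => [v|] //=; case: (f' u).
Qed.

Lemma exp_tensor1 : exp_tensor 1%g 1%g = 1%g.
Proof.
rewrite /exp_tensor pinj_prod1; apply: pinj_ext => n.
by congr Some; exact: psi_invK.
Qed.

Lemma exp_tensorM (f f' g g' : End nat) :
  exp_tensor (f' * f)%g (g' * g)%g = (exp_tensor f' g' * exp_tensor f g)%g.
Proof.
rewrite /exp_tensor pinj_prodM; apply: pinj_ext => n /=.
by case: (pinj_prod_fun f g (psi_inv n)) => [p|] //=; rewrite psiK.
Qed.

Theorem lemma4p9 : @monoid_morphism (End nat) (End nat) bang.
Proof.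
split=> [|f g]; first exact: exp_tensor1.
by rewrite /bang -exp_tensorM mul1g.
Qed.
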